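(* Let $A:\ell^1(\mathbb{N})\to\ell^2(\mathbb{N})$ be the bounded linear operator $[Ax]_k:=\frac{x_k-x_{k+1}}{k}$, $k\in\mathbb{N}$. Then for every $c\in(0,1)$ and every $n\in\mathbb{N}$ the source set $S^{(n)}(c)$ (defined in the context, with $Y=\ell^2(\mathbb{N})$) is nonempty.
   Context: $\mathbb{N}=\{1,2,\ldots\}$; all sequences are real; $e^{(k)}$ is the unit sequence with $1$ at position $k$ and $0$ elsewhere. $Y=\ell^2(\mathbb{N})$ and $Y^*$ is identified with $\ell^2(\mathbb{N})$. $A^*:Y^*\to\ell^\infty(\mathbb{N})$ is the adjoint of $A:\ell^1(\mathbb{N})\to Y$, so $[A^*f]_l=\langle f,Ae^{(l)}\rangle$. Source sets: for $c\in[0,1)$ and $n\in\mathbb{N}$, $S^{(n)}(c)\subseteq(Y^* )^n$ is the set of all $(f^{(n,1)},\ldots,f^{(n,n)})\in(Y^* )^n$ such that (i) for each $k\in\{1,\ldots,n\}$, $[A^*f^{(n,k)}]_k=1$ and $[A^*f^{(n,k)}]_l=0$ for $l\in\{1,\ldots,n\}\setminus\{k\}$; and (ii) $\sum_{k=1}^n|[A^*f^{(n,k)}]_l|\le c$ for all $l>n$. *)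

(* Defs.v *)
From HB Require Import structures.
From mathcomp Require Import all_boot all_order all_algebra.
From mathcomp Require Import all_classical all_reals all_analysis.

Set Implicit Arguments.
Unset Strict Implicit.
Unset Printing Implicit Defensive.
Import Order.TTheory GRing.Theory Num.Theory.
Import numFieldNormedType.Exports.
Local Open Scope classical_set_scope.
Local Open Scope ring_scope.

(* Sequences indexed by {1, 2, ...} are rendered as functions on nat, index k
   standing for position k.+1. *)

(* Only the empty set is null for the counting measure, so these are spaces of
   honest sequences and no quotient is needed. *)
Definition ell1 (R : realType) := LfunType (@counting nat R) (lexx 1%E).
Definition ell2 (R : realType) := LfunType (@counting nat R) (lee1n 2).

Section sequence_spaces.
Context {R : realType}.
Local Notation "'N_ p [ f ]" := (Lnorm (@counting nat R) p (EFin \o f)).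

Lemma Lnorm1_counting (f : nat -> R) :
  'N_1%E [f] = (\sum_(k <oo) `|f k|%:E)%E.
Proof. by rewrite Lnorm1 ge0_integral_count. Qed.

Lemma Lfun_countingP (p : \bar R) (f : nat -> R) :
  f \in Lfun counting p <-> ('N_p [f] < +oo)%E.
Proof.
split=> [|fp]; first by rewrite inE => /andP[_]; rewrite inE.
rewrite inE; apply/andP; split; rewrite inE//.
Qed.

Lemma le_abs_Lnorm1_counting (f : nat -> R) k : (`|f k|%:E <= 'N_1%E [f])%E.
Proof.
rewrite Lnorm1_counting (@nneseriesD1 _ _ k)//.
by rewrite leeDl// nneseries_ge0.
Qed.

Lemma Lnorm2_le_Lnorm1_counting (f : nat -> R) :
  ('N_2%:E [f] <= 'N_1%E [f])%E.
Proof.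
have := @le_abs_Lnorm1_counting f; have := Lnorm1_counting f.
have := Lnorm_ge0 counting 1%E (EFin \o f).
case: ('N_1%E [f])%E => [s||]//; last by move=> *; rewrite leey.
rewrite lee_fin => s0 sE fs.
rewrite Lnorm_counting//.
have -> : (s%:E = (s ^+ 2)%:E `^ (2^-1))%E.
  by rewrite poweR_EFin -powR_mulrn// -powRrM mulfV// powRr1.
apply: gt0_ler_poweR; rewrite ?invr_ge0//.
- by rewrite in_itv/= leey andbT nneseries_ge0// => k _ _; exact: poweR_ge0.
- by rewrite in_itv/= leey andbT lee_fin sqr_ge0.
rewrite expr2 EFinM [X in (_ * X)%E]sE -nneseriesZl//.
apply: lee_nneseries => k _; first by rewrite poweR_ge0.
rewrite /= -EFinM lee_fin powR_mulrn// expr2.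
by rewrite ler_wpM2r// -lee_fin.
Qed.

Lemma Lfun1_Lfun2_counting (f : nat -> R) :
  f \in Lfun counting 1%E -> f \in Lfun counting 2%:E.
Proof.
move=> /Lfun_countingP f1; apply/Lfun_countingP.
exact: le_lt_trans (Lnorm2_le_Lnorm1_counting f) f1.
Qed.

Definition unit_seq (k : nat) : nat -> R := fun i => (i == k)%:R.

Lemma unit_seq_Lfun1 (k : nat) : unit_seq k \in Lfun counting 1%E.
Proof.
apply/Lfun_countingP; rewrite Lnorm1_counting (@nneseriesD1 _ _ k)//.
rewrite eseries0 ?adde0 ?ltry// => i _ /andP[_ ik].
by rewrite /unit_seq (negbTE ik) normr0.
Qed.

Definition unit_ell1 (k : nat) : ell1 R := Lfun_Sub (lexx 1%E) (unit_seq_Lfun1 k).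

(* The duality pairing between Y^* and Y, both identified with ell2. *)
Definition pairing (f y : ell2 R) : R := limn (series (fun k => f k * y k)).

Lemma is_cvg_pairing (f y : ell2 R) : cvgn (series (fun k => f k * y k)).
Proof.
have /Lfun_countingP := Lfun2_mul_Lfun1 (LfunP f) (LfunP y).
rewrite Lnorm1_counting => fy; apply: (@normed_cvg _ R).
by apply: nnseries_is_cvg => /=.
Qed.

(* A^* f is an element of ell^infty = (ell^1)^*, given by its coordinates on the
   unit sequences. *)
Definition adjoint (A : {linear ell1 R -> ell2 R}) (f : ell2 R) : nat -> R :=
  fun l => pairing f (A (unit_ell1 l)).

Definition source_set (A : {linear ell1 R -> ell2 R}) (n : nat) (c : R) :
    set ('I_n -> ell2 R) :=
  [set f | (forall k : 'I_n, adjoint A (f k) k = 1 /\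
              forall l : 'I_n, l != k -> adjoint A (f k) l = 0) /\
           (forall l : nat, (n <= l)%N ->
              \sum_(k < n) `|adjoint A (f k) l| <= c)].

(* The denominator is k.+1 because of the shift of indices. *)
Definition diff_seq (x : nat -> R) : nat -> R :=
  fun k => (x k - x k.+1) / k.+1%:R.

Lemma Lnorm1_diff_seq (x : nat -> R) :
  ('N_1%E [diff_seq x] <= 2%:E * 'N_1%E [x])%E.
Proof.
rewrite !Lnorm1_counting.
apply: (@le_trans _ _ (\sum_(k <oo) (`|x k|%:E + `|x k.+1|%:E))%E).
  apply: lee_nneseries => k _; first by rewrite lee_fin.
  rewrite -EFinD lee_fin /diff_seq normrM normfV normr_nat.
  rewrite ler_pdivrMr// (le_trans (ler_normB _ _))// ler_peMr ?addr_ge0//.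
  by rewrite ler1n.
rewrite nneseriesD// mule_natl mule2n leeD2l//.
rewrite [leRHS]nneseries_recl// -[X in (_ <= _ + X)%E]nneseries_addn//.
rewrite [X in (_ <= _ + X)%E](eq_eseriesr (fun k _ => congr1 (fun i => `|x i|%:E) (addn1 k))).
by rewrite leeDr.
Qed.

Lemma diff_seq_Lfun2 (x : ell1 R) : diff_seq x \in Lfun counting 2%:E.
Proof.
apply: Lfun1_Lfun2_counting; apply/Lfun_countingP.
apply: le_lt_trans (Lnorm1_diff_seq x) _.
by rewrite lte_mul_pinfty//; exact: Lfunction_finite.
Qed.

Definition diff_op (x : ell1 R) : ell2 R := Lfun_Sub (lee1n 2) (diff_seq_Lfun2 x).

Fact diff_op_is_linear : linear diff_op.
Proof.
move=> a x y; apply/LfuneqP => k.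
have -> : diff_op (a *: x + y) k =
  (a * x k + y k - (a * x k.+1 + y k.+1)) / k.+1%:R by [].
have -> : (a *: diff_op x + diff_op y : ell2 R) k =
  a * diff_op x k + diff_op y k by [].
rewrite /= /diff_seq mulrA -mulrDl; congr (_ / _).
by rewrite mulrBr opprD addrACA.
Qed.

HB.instance Definition _ :=
  GRing.isLinear.Build R (ell1 R) (ell2 R) *:%R diff_op diff_op_is_linear.

Lemma diff_op_bounded (x : ell1 R) :
  ('N_2%:E [diff_op x] <= 2%:E * 'N_1%E [x])%E.
Proof. exact: le_trans (Lnorm2_le_Lnorm1_counting _) (Lnorm1_diff_seq x). Qed.

End sequence_spaces.

Arguments source_set {R} A n c.

(* Main.v *)
Require Import Defs.
From HB Require Import structures.
From mathcomp Require Import all_boot all_order all_algebra.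
From mathcomp Require Import all_classical all_reals all_analysis.
From mathcomp Require Import lra.
Import Order.TTheory GRing.Theory Num.Theory.
Import numFieldNormedType.Exports.
Local Open Scope classical_set_scope.
Local Open Scope ring_scope.

(* Writing f_k = k g_k one finds [A^* f]_l = g_l - g_(l-1), with g_0 = 0. Hence
   f^(n,k) is obtained from a sequence g that jumps from 0 to 1 at position k,
   stays equal to 1 up to position n, and then decreases to 0 in steps of length
   at most c / n; since g reaches 0 after finitely many steps, f has finite
   support. *)

Lemma finite_support_Lfun1 (R : realType) (f : nat -> R) (N : nat) :
  (forall k, (N <= k)%N -> f k = 0) -> f \in Lfun counting 1%E.
Proof.
move=> f0; apply/Lfun_countingP; rewrite Lnorm1_counting.
rewrite (nneseries_split 0%N N)// [X in (_ + X)%E]eseries0 ?adde0; last first.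
  by move=> k Nk _; rewrite f0 ?normr0.
by rewrite sumEFin ltry.
Qed.

(** The image of a unit sequence has at most two nonzero entries, at [l] and at its predecessor, so
    the pairing is a finite sum. At [l = 0] there is no predecessor, whence the default 0. *)
Lemma adjoint_diff_op (R : realType) (f : ell2 R) (l : nat) :
  adjoint (@diff_op R) f l =
  f l / l.+1%:R - (if l is m.+1 then f m / m.+1%:R else 0).
Proof.
pose u k : R := f k * diff_seq (unit_seq l) k.
have uE k : u k = f k * (((k == l)%:R - (k.+1 == l)%:R) / k.+1%:R) by [].
have u0 k : k != l -> k.+1 != l -> u k = 0.
  by move=> /negbTE kl /negbTE k1l; rewrite uE kl k1l subrr mul0r mulr0.
(* The partial sums are constant beyond [l], so their limit is that constant. *)
suff sumE N : (l < N)%N -> \sum_(0 <= k < N) u k =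
    f l / l.+1%:R - (if l is m.+1 then f m / m.+1%:R else 0).
  apply: lim_near_cst => //; near=> N.
  by apply: sumE; near: N; exact: nbhs_infty_ge.
move=> lN; rewrite (@big_cat_nat _ _ _ l.+1)//=.
rewrite [X in _ + X]big_nat [X in _ + X]big1 ?addr0; last first.
  by move=> k /andP[lk _]; rewrite u0// gtn_eqF// ltnW.
rewrite big_nat_recr//= [u l]uE eqxx gtn_eqF// subr0 mul1r addrC; congr (_ + _).
case: l @u uE u0 {lN} => [|m] u uE u0; first by rewrite big_geq// oppr0.
rewrite big_nat_recr//= uE eqxx ltn_eqF// big_nat big1 ?add0r; last first.
  by move=> k km; rewrite u0// ltn_eqF// ltnW.
by rewrite mulNr mul1r mulrN.
Unshelve. all: by end_near. Qed.

(* Truncated subtraction makes [ramp n d] equal to 1 on indices below [n]. *)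
Definition ramp (R : realType) (n : nat) (d : R) (l : nat) : R :=
  Num.max 0 (1 - d *+ (l.+1 - n)).

Lemma ramp_ltn (R : realType) (n : nat) (d : R) (l : nat) :
  (l < n)%N -> ramp R n d l = 1.
Proof.
by move=> ln; rewrite /ramp (eqP ln) mulr0n subr0; exact/max_idPr.
Qed.

Lemma ramp_eventually0 (R : realType) (n : nat) (d : R) : 0 < d ->
  exists N, forall l, (N <= l)%N -> ramp R n d l = 0.
Proof.
(* By the Archimedean property, [Num.bound d^-1] steps of length [d] cover the descent from 1 to
   0. *)
move=> d0; exists (n + Num.bound d^-1)%N => l Nl; apply/max_idPl.
rewrite subr_le0 -mulr_natl -ler_pdivrMr// mul1r.
have dV0 : 0 <= d^-1 by rewrite invr_ge0 ltW.
apply: le_trans (ltW (archi_boundP dV0)) _; rewrite ler_nat.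
by rewrite leq_subRL ?(leq_trans Nl)// (leq_trans (leq_addr _ _) (leqW Nl)).
Qed.

(** Before truncation at 0 the two values differ by exactly [d], and truncation does not increase
    distances. The case [n = l.+1] is the first step down from 1. *)
Lemma ramp_step (R : realType) (n : nat) (d : R) (l : nat) :
  0 < d -> (n <= l.+1)%N -> `|ramp R n d l.+1 - ramp R n d l| <= d.
Proof.
move=> d0 nl; rewrite /ramp subSn// mulrS.
set t := d *+ _.
rewrite ler_norml !maxEle.
by case: ifPn; case: ifPn; rewrite -?ltNge => *; apply/andP; split; lra.
Qed.

Theorem proposition3p8 (R : realType) (c : R) (n : nat) :
  0 < c < 1 -> (0 < n)%N -> source_set (@diff_op R) n c !=set0.
Proof.
(* Each of the [n] sources contributes at most [d] beyond position [n], for a total of at most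
   [c]. *)
move=> /andP[c0 _] n0; set d := c / n%:R.
have d0 : 0 < d by rewrite divr_gt0// ltr0n.
pose g (k l : nat) : R := (k <= l)%:R * ramp R n d l.
have gL2 k : (fun l => l.+1%:R * g k l) \in Lfun counting 2%:E.
  have [N rampN] := ramp_eventually0 R n d d0.
  apply/Lfun1_Lfun2_counting/(finite_support_Lfun1 R _ N) => l Nl.
  by rewrite /g rampN// !mulr0.
pose f (k : 'I_n) : ell2 R := Lfun_Sub (lee1n 2) (gL2 k).
have fE k l : f k l / l.+1%:R = g k l by rewrite /= mulrAC mulfV ?mul1r.
have adjE k l : adjoint (@diff_op R) (f k) l =
    g k l - (if l is m.+1 then g k m else 0).
  by rewrite adjoint_diff_op fE; case: l => // m; rewrite fE.
exists f; split=> [k|l nl].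
  have adjn (l : 'I_n) : adjoint (@diff_op R) (f k) l = (l == k)%:R.
    (* Below [n] the ramp is 1, so only the jump of the indicator of [k <= l] remains. *)
    rewrite adjE /g ramp_ltn// mulr1 -val_eqE /=.
    case: l => -[|m] /= mn; first by rewrite subr0 leqn0 eq_sym.
    rewrite (ramp_ltn _ _ _ _ (ltnW mn)) mulr1 leq_eqVlt ltnS eq_sym.
    by case: eqVneq => [<-|_]; rewrite ?ltnn ?subr0 ?subrr.
  by split=> [|l /negbTE lk]; rewrite adjn ?eqxx ?lk.
have -> : c = \sum_(k < n) d.
  by rewrite sumr_const card_ord -mulr_natr divfK// pnatr_eq0 -lt0n.
apply: ler_sum => k _; rewrite adjE.
(* Both [m] and [m.+1] are at least [k], so the indicators are 1 and the difference is a single ramp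
   step. *)
case: l nl => [|m] nm; first by rewrite leqNgt n0 in nm.
have km : (k <= m)%N by rewrite -ltnS (leq_trans (ltn_ord k)).
by rewrite /g km leqW// !mul1r ramp_step.
Qed.
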